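(* Let $w \ge 1$ and $a \ge 0$ be integers, let $n = 2w+a$, and suppose that there exists a nontrivial $1$-perfect code $C$ in $J(n,w)$. Then the integer $\Phi_1(w,a) = 1 + w(w+a)$ is squarefree.
   Context: For integers $0 \le w \le n$, the Johnson graph $J(n,w)$ has as vertex set $V^n_w$, the set of all $w$-element subsets of $\{1,2,\ldots,n\}$; two vertices are adjacent if their intersection has size $w-1$. The distance between two $w$-sets is half the size of their symmetric difference. The $1$-sphere of a vertex is the set of all $w$-sets within distance at most $1$ of it; for $n=2w+a$ it has cardinality $\Phi_1(w,a)=1+w(w+a)$. A code $C \subseteq V^n_w$ is called $1$-perfect if the $1$-spheres of the codewords of $C$ form a partition of $V^n_w$. A $1$-perfect code is called trivial if it consists of a single codeword, or if $n=2w$ and it consists of a pair of disjoint $w$-subsets; otherwise it is nontrivial. *)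

(* Defs.v *)
From mathcomp Require Import all_boot.

Set Implicit Arguments.
Unset Strict Implicit.
Unset Printing Implicit Defensive.

(* The ground set {1, ..., n} is represented by 'I_n. *)

Definition johnson_vertices (n w : nat) : {set {set 'I_n}} :=
  [set A : {set 'I_n} | #|A| == w].

(* The symmetric difference of two sets of equal size has even size, so the
   halving is exact on the vertices of J(n, w). *)
Definition johnson_dist (n : nat) (A B : {set 'I_n}) : nat :=
  #|(A :\: B) :|: (B :\: A)|./2.

Definition sphere1 (n w : nat) (A : {set 'I_n}) : {set {set 'I_n}} :=
  [set B in johnson_vertices n w | johnson_dist A B <= 1].

(* The spheres partition the vertex set as a family indexed by the codewords:
   since [partition] only sees the set of spheres, injectivity rules out two
   distinct codewords sharing a sphere (as could happen when w = 1). *)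
Definition perfect1 (n w : nat) (C : {set {set 'I_n}}) : Prop :=
  [/\ C \subset johnson_vertices n w,
      partition [set sphere1 w A | A in C] (johnson_vertices n w)
    & {in C &, injective (@sphere1 n w)}].

Definition trivial_code (n w : nat) (C : {set {set 'I_n}}) : Prop :=
  #|C| = 1 \/
  n = 2 * w /\
  exists A B : {set 'I_n},
    [/\ A \in johnson_vertices n w, B \in johnson_vertices n w,
        [disjoint A & B] & C = [set A; B]].

(* The cardinality of a 1-sphere of J(2 * w + a, w). *)
Definition Phi1 (w a : nat) : nat := 1 + w * (w + a).

Definition squarefree (m : nat) : Prop :=
  forall d : nat, d ^ 2 %| m -> d = 1.

(* Main.v *)
Require Import Defs.
From mathcomp Require Import all_boot.
From mathcomp Require Import zify.

Set Implicit Arguments.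
Unset Strict Implicit.
Unset Printing Implicit Defensive.

(** Write [x] for the codimension [w - #|T|] of a set [T] of at most [w] points.
    Counting the [w]-sets above [T] through the unique codeword near each of
    them relates the number [c T] of codewords containing [T] to the numbers
    [c (T :\ t)] ([perfect_through_recurrence]); the resulting coefficient of
    [c T] is the eigenvalue [1 + x * (x + a + 1) - w] of a sphere operator of
    the Johnson scheme.  As long as it stays positive, induction on [#|T|] gives
    [c T * Phi1 w a = 'C(w + a + x, x)] ([perfect_is_design]).  So a perfect
    code yields

      [Phi1 w a %| 'C(w + a + x, x)]  for all [x <= w <= x * (x + a + 1)],

    and only these divisibilities (together with [c set0 = #|C|] when [w = 1])
    are used to prove squarefreeness.

    Taking [x = 2] shows that [2 * a + 6 < w] or [w = a + 3]; in the second case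
    the code is a Steiner system S(w - 2, w, 3w - 3).  Either way
    [y = w + a] is less than [2 * w].

    Let now [p ^ 2 %| Phi1 w a] with [p] prime and [p ^ m <= w < p ^ m.+1], and
    take for [x] the number [w] with all its base-[p] digits but the leading one
    replaced by 0.  Then [w < 2 * x], so [p ^ 2] divides ['C(y + x, x)].  By
    Kummer's theorem the addition [y + x] must have two carries in base [p].
    The digits of [x] below position [m] vanish, so the carries would be at
    positions [m] and [m + 1], and [y + x >= p ^ m.+2].  But [y < 2 * p ^ m.+1]
    and [x < p ^ m.+1], which excludes this for [p >= 3]; for [p = 2] it is
    excluded by [y < 3 * 2 ^ m] when [2 * a + 6 < w].  In the remaining case
    [p = 2], [w = a + 3], the divisibility for [x = 4] makes
    [w * (2 * w + 1)] a multiple of 6 although [w] is odd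
    ([perfect_steiner_not_dvd4]). *)

(** * Spheres in the Johnson graph *)

Definition swap (T : finType) (B : {set T}) (b t : T) : {set T} :=
  t |: (B :\ b).

Section Spheres.

Variables n w : nat.
Implicit Types A B T : {set 'I_n}.

Lemma swap_inj B :
  {in setX B (~: B) &, injective (fun p => swap B p.1 p.2)}.
Proof.
move=> [b t] [b' t']; rewrite !inE /= => /andP[bB tB] /andP[b'B _] /setP eqS.
have := eqS t; rewrite !inE eqxx (negbTE tB) !andbF !orbF => /esym/eqP tt'.
subst t'.
have := eqS b; rewrite !inE eqxx bB /= orbF andbT.
have [bt|_] := eqVneq b t; first by rewrite -bt bB in tB.
by have [->|] := eqVneq b b'.
Qed.

Lemma johnson_distE A B :
  #|A| = #|B| -> johnson_dist A B = #|A :\: B|.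
Proof.
move=> eqAB; rewrite /johnson_dist cardsU.
have -> : (A :\: B) :&: (B :\: A) = set0.
  by apply/setP => x; rewrite !inE; case: (x \in A); case: (x \in B).
have := cardsID B A; have := cardsID A B; rewrite setIC cards0; lia.
Qed.

Lemma sphere1E B : B \in johnson_vertices n w ->
  sphere1 w B = B |: [set swap B p.1 p.2 | p in setX B (~: B)].
Proof.
rewrite inE => /eqP Bw; apply/setP => A; rewrite !inE.
apply/andP/orP => [[/eqP Aw] | [/eqP->|/imsetP[[b t]]]].
- have eqBA : #|B| = #|A| by rewrite Bw.
  rewrite johnson_distE // leq_eqVlt ltnS leqn0 => /orP[/cards1P[b Bb]|].
    have /cards1P[t At] : #|A :\: B| == 1.
      have := cardsID B A; have := cardsID A B; rewrite setIC Bb cards1; lia.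
    right; apply/imsetP; exists (b, t) => /=.
      have := set11 b; have := set11 t; rewrite -At -Bb !inE.
      by move=> /andP[-> _] /andP[_ ->].
    apply/setP => x; have /setP/(_ x) := At; have /setP/(_ x) := Bb.
    rewrite !inE => <- <-; by case: (x \in A); case: (x \in B).
  rewrite cards_eq0 setD_eq0 => sBA; left.
  by rewrite eq_sym eqEcard sBA eqBA leqnn.
- by rewrite Bw johnson_distE // setDv cards0.
- rewrite !inE /= => /andP[bB tB] ->.
  have sw : #|swap B b t| = w.
    rewrite /swap cardsU1 !inE (negbTE tB) andbF /=.
    by have := cardsD1 b B; rewrite bB Bw => ->.
  rewrite sw eqxx johnson_distE ?sw ?Bw //; split=> //.
  rewrite -(cards1 b) subset_leq_card //; apply/subsetP => x.
  by rewrite !inE negb_or negb_and negbK; case: (x \in B);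
    rewrite ?andbF ?orbF // andbT => /andP[].
Qed.

(** The condition splits into one on [b] and one on [t]; this is what turns the
    count over the sphere in [sum_sphere1] into a product. *)
Lemma swap_superset T B b t : b \in B -> t \notin B ->
  (T \subset swap B b t) = (b \notin T) && (T :\: B \subset [set t]).
Proof.
move=> bB tB; apply/subsetP/andP => [sT | [bT /subsetP sT] x xT].
  split.
    apply/negP => /sT; rewrite !inE eqxx orbF => /eqP bt.
    by rewrite -bt bB in tB.
  apply/subsetP => x; rewrite !inE => /andP[xB /sT].
  by rewrite !inE (negbTE xB) andbF orbF.
rewrite !inE; case: (boolP (x \in B)) => xB.
  by have [xb|_] := eqVneq x b; [rewrite -xb xT in bT | rewrite orbT].
by have := sT x; rewrite !inE xB xT /= => ->.
Qed.

Lemma sum_sphere1 T B : B \in johnson_vertices n w ->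
  \sum_(A in sphere1 w B) (T \subset A : nat) =
  (T \subset B) + #|B :\: T| * \sum_(t in ~: B) (T :\: B \subset [set t]).
Proof.
move=> BV; rewrite sphere1E // big_setU1 /=; last first.
  apply/imsetP => -[[b t]]; rewrite !inE /= => /andP[bB tB] /setP/(_ t).
  by rewrite !inE eqxx (negbTE tB).
congr (_ + _); rewrite (big_imset _ (@swap_inj B)) /=.
rewrite (eq_bigl (fun p => (p.1 \in B) && (p.2 \in ~: B))); last first.
  by case=> b t; rewrite in_setX.
rewrite -(pair_big (fun b => b \in B) (fun t => t \in ~: B)
           (fun b t => nat_of_bool (T \subset swap B b t))) /=.
rewrite -sum1_card big_distrl /=.
rewrite [RHS](eq_bigl (fun b => (b \in B) && (b \notin T))); last first.
  by move=> b; rewrite !inE andbC.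
rewrite big_mkcondr; apply: eq_bigr => b bB.
case: (boolP (b \in T)) => bT; rewrite ?mul1n /=.
  by apply: big1 => t; rewrite inE => tB; rewrite swap_superset // bT.
by apply: eq_bigr => t; rewrite inE => tB; rewrite swap_superset // bT.
Qed.

(** Contribution of one codeword [B] to the recurrence below.  Only codewords
    missing at most one point of [T] matter.  If [T \subset B], both sides count
    [1 + (w - #|T|) * (n - w) + #|T| * (w - #|T| + 1)]; if [B] misses exactly
    one point [u] of [T], the vertices of its sphere above [T] are the swaps
    that bring in [u], so both sides are [w - #|T| + 1].  The second summand on
    the left compensates for the [t \in T] with [T \subset B] on the right,
    so that no subtraction is needed. *)
Lemma sphere1_local_identity T B : B \in johnson_vertices n w -> #|T| <= w ->
  \sum_(A in sphere1 w B) (T \subset A : nat)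
    + #|T| * (w - #|T| + 1) * (T \subset B) =
  (1 + (w - #|T|) * (n - w)) * (T \subset B)
    + (w - #|T| + 1) * \sum_(t in T) (T :\ t \subset B).
Proof.
move=> BV Tw; rewrite sum_sphere1 //; move: BV; rewrite inE => /eqP Bw.
have -> : \sum_(t in T) (T :\ t \subset B : nat) =
          \sum_(t in T) (T :\: B \subset [set t] : nat).
  by apply: eq_bigr => t _; rewrite !subDset setUC.
case: (boolP (T \subset B)) => TB.
  have TB0 : T :\: B = set0 by apply/eqP; rewrite setD_eq0.
  have E (S : {set 'I_n}) : \sum_(t in S) (T :\: B \subset [set t] : nat) = #|S|.
    by rewrite -sum1_card; apply: eq_bigr => t _; rewrite TB0 sub0set.
  rewrite !E cardsD (setIidPr TB) Bw.
  have -> : n - w = #|~: B| by rewrite [RHS]cardsCs setCK card_ord Bw.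
  by rewrite muln1; lia.
rewrite !muln0 !add0n addn0.
have E (S : {set 'I_n}) : \sum_(t in S) (T :\: B \subset [set t] : nat) =
    \sum_(t in S) (T :\: B == [set t] : nat).
  by apply: eq_bigr => t _; rewrite subset1 setD_eq0 (negbTE TB) orbF.
rewrite !E.
have [/cards1P[u Tu]|TB1] := boolP (#|T :\: B| == 1); last first.
  have F (S : {set 'I_n}) : \sum_(t in S) (T :\: B == [set t] : nat) = 0.
    apply: big1 => t _; case: eqP => // Tt.
    by rewrite Tt cards1 in TB1.
  by rewrite !F !muln0.
have F (S : {set 'I_n}) : u \in S -> \sum_(t in S) (T :\: B == [set t] : nat) = 1.
  move=> uS; rewrite (bigD1 u) //= Tu eqxx big1 // => t /andP[_ tu].
  by case: eqP => // /setP/(_ t); rewrite !inE eqxx (negbTE tu).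
have := set11 u; rewrite -Tu inE => /andP[uB uT].
rewrite !F ?inE // !muln1.
have := cardsID B T; have := cardsID T B; rewrite setIC Tu cards1; lia.
Qed.

Lemma card_supersets T : #|T| <= w -> w <= n ->
  \sum_(A in johnson_vertices n w) (T \subset A : nat) = 'C(n - #|T|, w - #|T|).
Proof.
move=> Tw wn; rewrite -big_mkcondr /= sum1dep_card.
have -> : n - #|T| = #|~: T| by rewrite [RHS]cardsCs setCK card_ord.
rewrite -cards_draws -[RHS](@card_in_imset _ _ (fun A => T :|: A)).
  apply: eq_card => A; rewrite !inE; apply/andP/imsetP => [[/eqP Aw TA] | [A']].
    exists (A :\: T); last by rewrite -[LHS](setID A T) (setIidPr TA).
    rewrite inE setDE subsetIr /= -setDE cardsD (setIidPr TA) Aw eqxx //.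
  rewrite inE => /andP[A'T /eqP A'w] ->; rewrite subsetUl; split=> //.
  rewrite cardsU; have -> : T :&: A' = set0.
    by apply/eqP; rewrite setI_eq0 disjoint_sym disjoints_subset.
  by rewrite A'w cards0 subn0 subnKC.
move=> A A'; rewrite !inE => /andP[/subsetP AT _] /andP[/subsetP A'T _].
move=> /setP eqA.
apply/setP => x; have := eqA x; have := AT x; have := A'T x; rewrite !inE.
case: (x \in T) => //= A'x Ax _.
by apply/idP/idP => [/Ax|/A'x].
Qed.

End Spheres.

(** * Perfect codes are designs *)

(** The cardinality of [[set B in C | T \subset B]], kept as a sum so that it
    can be exchanged with other sums. *)
Definition codewords_through n (C : {set {set 'I_n}}) (T : {set 'I_n}) : nat :=
  \sum_(B in C) (T \subset B).

(** Every vertex above [T] lies in the sphere of exactly one codeword, so summing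
    the identity of a single codeword over [C] makes the sphere sums add up to
    the number of all vertices above [T]. *)
Lemma perfect_through_recurrence n w (C : {set {set 'I_n}}) (T : {set 'I_n}) :
  perfect1 w C -> w <= n -> #|T| <= w ->
  'C(n - #|T|, w - #|T|) + #|T| * (w - #|T| + 1) * codewords_through C T =
  (1 + (w - #|T|) * (n - w)) * codewords_through C T
    + (w - #|T| + 1) * \sum_(t in T) codewords_through C (T :\ t).
Proof.
move=> [/subsetP CV /and3P[/eqP cov triv _] inj] wn Tw.
rewrite -card_supersets // -cov (big_trivIset _ triv) (big_imset _ inj) /=.
rewrite /codewords_through exchange_big !big_distrr -!big_split /=.
by apply: eq_bigr => B /CV BV; rewrite -sphere1_local_identity.
Qed.

(** Induction on [#|T|]: the hypothesis on [x] says that the eigenvalue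
    [1 + x * (x + a + 1) - w] is positive, and it is inherited by all larger [x],
    that is, by all smaller sets.  The recurrence then determines the number of
    codewords through [T], whatever the position of [T]. *)
Lemma perfect_is_design w a (C : {set {set 'I_(2 * w + a)}}) x
    (T : {set 'I_(2 * w + a)}) :
  perfect1 w C -> x <= w -> w <= x * (x + a + 1) -> #|T| = w - x ->
  codewords_through C T * Phi1 w a = 'C(w + a + x, x).
Proof.
move=> perfC; move Ei : (w - x) => i.
elim: i x T Ei => [|i IH] x T Ei xw cond cT;
  have w_le : w <= 2 * w + a by lia.
  have := perfect_through_recurrence (T := T) perfC w_le.
  have -> : x = w by lia.
  have -> : w + a + w = 2 * w + a by lia.
  rewrite cT !subn0 mul0n mul0n addn0 (cards0_eq cT) big_set0 muln0 addn0.
  move=> -> //; rewrite mulnC /Phi1; congr (_ * _); congr (_ + _ * _); lia.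
have := perfect_through_recurrence (T := T) perfC w_le; rewrite cT.
have -> : 2 * w + a - i.+1 = w + a + x by lia.
have -> : w - i.+1 = x by lia.
have -> : 2 * w + a - w = w + a by lia.
have -> : i < w by lia.
move=> /(_ isT) /(congr1 (muln^~ (Phi1 w a))) /=.
have step t : t \in T ->
    codewords_through C (T :\ t) * Phi1 w a = 'C(w + a + x.+1, x.+1).
  move=> tT; apply: IH; [lia | lia | nia |].
  by have := cardsD1 t T; rewrite tT cT => -[].
rewrite !mulnDl -!mulnA.
have -> : (\sum_(t in T) codewords_through C (T :\ t)) * Phi1 w a
          = i.+1 * 'C(w + a + x.+1, x.+1).
  by rewrite big_distrl /= -cT -sum_nat_const; apply: eq_bigr.
have := mul_bin_diag (w + a + x.+1) x; rewrite addnS /=.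
move: (codewords_through C T * Phi1 w a) => D.
set b := 'C(_, x); set b' := 'C(_, x.+1) => diag rec.
rewrite /Phi1 in rec *.
(* K.+1 is the eigenvalue 1 + x * (x + a + 1) - w. *)
have [K defK] : exists K, 1 + x * (w + a) = K.+1 + i.+1 * (x + 1).
  by exists (x * (w + a) - i.+1 * (x + 1)); nia.
have Phi_eq : 1 + w * (w + a) = K.+1 + i.+1 * (w + a + x).+1.
  have w_eq : w = x + i.+1 by lia.
  rewrite w_eq in defK *; nia.
apply/eqP; rewrite -(eqn_pmul2l (ltn0Sn K)); apply/eqP.
rewrite Phi_eq in rec.
nia.
Qed.

Lemma perfect_dvd_binomial w a (C : {set {set 'I_(2 * w + a)}}) x :
  perfect1 w C -> x <= w -> w <= x * (x + a + 1) ->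
  Phi1 w a %| 'C(w + a + x, x).
Proof.
move=> perfC xw cond.
have : w - x <= #|[set: 'I_(2 * w + a)]| by rewrite cardsT card_ord; lia.
have : exists T : {set 'I_(2 * w + a)}, #|T| = w - x.
  have : 0 < #|[set T : {set 'I_(2 * w + a)} | #|T| == w - x]|.
    by rewrite card_draws card_ord bin_gt0; lia.
  by case/card_gt0P => T; rewrite inE => /eqP; exists T.
by case=> T cT _; rewrite -(perfect_is_design perfC xw cond cT) dvdn_mull.
Qed.

(** * Binomial coefficients with at most one carry *)

Lemma logn_fact_widen p n N : prime p -> n <= N ->
  logn p n`! = \sum_(1 <= k < N.+1) n %/ p ^ k.
Proof.
move=> p_pr nN; rewrite logn_fact // [RHS](@big_cat_nat _ _ _ n.+1) //=.
rewrite [X in _ + X]big_nat_cond [X in _ + X]big1 ?addn0 //.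
move=> k /andP[/andP[nk _] _].
rewrite divn_small //; apply: leq_trans (ltn_expl n (prime_gt1 p_pr)) _.
by rewrite leq_exp2l ?prime_gt1 // ltnW.
Qed.

(** Adding [x] to [y] in base [p] produces no carry out of a position below [m],
    where the digits of [x] vanish, nor out of a position above [m], by the size
    of the sum.  In Legendre's formula only the term of [p ^ m.+1] can thus
    contribute to the valuation, and it contributes at most 1. *)
Lemma logn_bin_le1 p m x y : prime p ->
  p ^ m %| x -> x + y < p ^ m.+2 -> logn p 'C(y + x, x) <= 1.
Proof.
move=> p_pr mx small.
have := bin_fact (leq_addl y x); rewrite addnK.
move/(congr1 (logn p)).
rewrite !lognM ?muln_gt0 ?fact_gt0 ?bin_gt0 ?leq_addl //.
rewrite !(@logn_fact_widen p _ (x + y)) ?leq_addr ?leq_addl // 1?addnC //.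
rewrite -big_split /= => E.
suff : \sum_(1 <= k < (x + y).+1) (y + x) %/ p ^ k <=
  \sum_(1 <= k < (x + y).+1) (x %/ p ^ k + y %/ p ^ k) + 1 by rewrite -E; lia.
apply: (@leq_trans (\sum_(1 <= k < (x + y).+1)
    (x %/ p ^ k + y %/ p ^ k + (k == m.+1)))).
  apply: leq_sum => k _; rewrite [y + x]addnC.
  case: (ltngtP k m.+1) => [km | km | ->]; last exact: leq_divDl.
    rewrite divnDl ?addn0 //; apply: dvdn_trans mx.
    by rewrite dvdn_exp2l.
  rewrite divn_small ?leq0n //; apply: leq_trans small _.
  by rewrite leq_exp2l ?prime_gt1.
rewrite big_split leq_add2l /=.
have -> : \sum_(1 <= k < (x + y).+1) (k == m.+1 : nat)
          = count_mem m.+1 (index_iota 1 (x + y).+1).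
  by rewrite -sum1_count [RHS]big_mkcond; apply: eq_bigr => k _ /=; case: ifP.
by rewrite count_uniq_mem ?iota_uniq // leq_b1.
Qed.

(** * Arithmetic of the parameters *)

(** For [w = 1] the number of codewords is [(a + 2) / Phi1 1 a = 1]. *)
Lemma perfect_nontrivial_size w a (C : {set {set 'I_(2 * w + a)}}) :
  0 < w -> perfect1 w C -> ~ trivial_code w C -> 1 < w.
Proof.
move=> w0 perfC ntC; rewrite ltn_neqAle w0 andbT; apply/eqP => w1.
apply: ntC; left.
have := perfect_is_design (x := w) (T := set0) perfC (leqnn w).
rewrite cards0 subnn => /(_ ltac:(lia) erefl).
have -> : codewords_through C set0 = #|C|.
  by rewrite -sum1_card; apply: eq_bigr => B _; rewrite sub0set.
by move: #|C| => c; rewrite /Phi1 -w1 bin1; nia.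
Qed.

(** A special case of Roos' bound [n <= 3 * (w - 1)], in which equality is forced.
    The hypothesis allows [x = 2], so [(y + 2) * (y + 1) = 2 * q * (1 + w * y)]
    with [y = w + a].  Modulo [y] this gives [2 * q = 2], and a [q > 1] would be
    at least [y / 2 + 1], which makes the right side too large.  Hence
    [q = 1], that is [y + 3 = 2 * w]. *)
Lemma perfect_narrow_width w a (C : {set {set 'I_(2 * w + a)}}) :
  1 < w -> perfect1 w C -> w <= 2 * a + 6 -> w = a + 3.
Proof.
move=> w1 perfC wa.
have /dvdnP[q] := perfect_dvd_binomial perfC w1 ltac:(lia).
move/(congr1 (muln 2)); rewrite -mul_bin_diag bin1 /Phi1.
rewrite addn2 /= => E.
have [y def_y] : exists y, y = w + a by exists (w + a).
rewrite -def_y in E.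
have q_gt0 : 0 < q by case: q E.
have q1 : q = 1.
  apply/eqP; rewrite eqn_leq q_gt0 andbT leqNgt; apply/negP => q_gt1.
  have mod_y : y * (y + 3) = y * (2 * q * w) + 2 * q.-1 by nia.
  have quot_lt : 2 * q * w < y + 3.
    rewrite -(ltn_pmul2l (m := y)); lia.
  have q_large : y + 2 <= 2 * q by nia.
  nia.
rewrite q1 in E; nia.
Qed.

(** The case [w = a + 3] of Steiner systems.  With [W] for the width,
    [Phi1 W (W - 3) = (2 * W - 1) * (W - 1)] divides ['C(2 * W + 1, 4)], and
    the quotient is [(2 * W + 1) * W / 6]; so [W] is even and [Phi1] is odd. *)
Lemma perfect_steiner_not_dvd4 w (C : {set {set 'I_(2 * w.+3 + w)}}) :
  perfect1 w.+3 C -> ~~ (2 ^ 2 %| Phi1 w.+3 w).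
Proof.
(* Phi1 3 0 = 10 settles width 3, for which x = 4 is too large. *)
case: w C => [//|w] C perfC; apply/negP => d4.
have odd_w : odd w.
  have : ~~ odd (Phi1 w.+4 w.+1).
    by rewrite -dvdn2; apply: dvdn_trans d4.
  by rewrite /Phi1 oddD oddM oddD /= !negbK; case: (odd w).
have /dvdnP[q] := perfect_dvd_binomial perfC (x := 4) isT ltac:(lia).
move/(congr1 (muln 24)).
have -> : w.+4 + w.+1 + 4 = (2 * w + 5).+4 by lia.
have := mul_bin_diag (2 * w + 5).+4 3.
have := mul_bin_diag (2 * w + 5).+3 2.
have := mul_bin_diag (2 * w + 5).+2 1.
rewrite /= bin1 => b2 b3 b4 E.
have Phi_eq : 1 + w.+4 * (w.+4 + w.+1) = (2 * w + 7) * (w + 3) by lia.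
rewrite /Phi1 Phi_eq in E.
have fact4 : 24 * 'C((2 * w + 5).+4, 4) =
    (2 * w + 9) * (2 * w + 8) * (2 * w + 7) * (2 * w + 6).
  rewrite -[24]/(2 * 3 * 4) -mulnA -b4 mulnCA -mulnA -b3 [2 * (_ * _)]mulnCA -b2.
  by clear; lia.
have regroup : (2 * w + 9) * (2 * w + 8) * (2 * w + 7) * (2 * w + 6) =
    (2 * w + 7) * (w + 3) * (4 * ((2 * w + 9) * (w + 4))).
  by clear; lia.
rewrite fact4 regroup (mulnA 24) [RHS]mulnC in E.
have {}E : (2 * w + 9) * (w + 4) = 6 * q.
  move/eqP: E; rewrite eqn_pmul2l; last by rewrite muln_gt0 !addn_gt0 !orbT.
  by move/eqP; set W := _ * _; lia.
by move/(congr1 odd): E; rewrite !(oddM, oddD) odd_w.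
Qed.

Theorem theorem4 (n w a : nat) (w_ge1 : 1 <= w) (n_def : n = 2 * w + a)
    (nontrivial_perfect :
       exists C : {set {set 'I_n}}, perfect1 w C /\ ~ trivial_code w C) :
  squarefree (Phi1 w a).
Proof.
subst n; case: nontrivial_perfect => C.
move=> [perfC /(perfect_nontrivial_size w_ge1 perfC) w1].
move=> d dPhi; apply/eqP; rewrite eqn_leq; apply/andP; split; last first.
  by case: d dPhi => //; rewrite dvd0n /Phi1.
rewrite leqNgt; apply/negP => d1.
have p_pr := pdiv_prime d1.
have pPhi : pdiv d ^ 2 %| Phi1 w a.
  by apply: dvdn_trans dPhi; rewrite dvdn_exp2r // pdiv_dvd.
move: (pdiv d) p_pr pPhi => {d d1 dPhi} p p_pr pPhi.
have dichotomy : w = a + 3 \/ 2 * a + 6 < w.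
  case: (leqP w (2 * a + 6)) => [/(perfect_narrow_width w1 perfC)|]; first by left.
  by right.
(* The Steiner case is singled out for p = 2 only: for odd p its bound
   y <= 2 * w - 3 is good enough. *)
have [[p2 wa] | not_steiner] : (p = 2 /\ w = a + 3) \/ (p = 2 -> 2 * a + 6 < w).
  have [p2|p_neq2] := eqVneq p 2; last by right=> p2; rewrite p2 in p_neq2.
  by case: dichotomy; [left | right].
  move: wa; rewrite addn3 => wa; subst w p.
  by rewrite (negbTE (perfect_steiner_not_dvd4 perfC)) in pPhi.
have /andP[pm_le lt_pm] := trunc_log_bounds (prime_gt1 p_pr) w_ge1.
move: (trunc_log p w) pm_le lt_pm => m pm_le lt_pm.
have pm_gt0 : 0 < p ^ m by rewrite expn_gt0 prime_gt0.
(* x keeps only the leading base-p digit c of w. *)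
pose c := w %/ p ^ m; pose x := c * p ^ m.
have x_le : x <= w by apply: leq_divM.
have c_gt0 : 0 < c by rewrite divn_gt0.
have w_lt : w < 2 * x.
  have : w < x + p ^ m
    by rewrite -ltn_psubLR // {1}(divn_eq w (p ^ m)) addKn ltn_mod.
  have : p ^ m <= x by rewrite leq_pmull.
  lia.
have Phi_dvd : Phi1 w a %| 'C(w + a + x, x).
  by apply: perfect_dvd_binomial perfC x_le _; nia.
have small : x + (w + a) < p ^ m.+2.
  rewrite !expnS in lt_pm *.
  case: (eqVneq p 2) not_steiner => [p2 /(_ p2) w_gt | p_neq2 _]; last first.
    have : 3 <= p by rewrite ltn_neqAle eq_sym p_neq2 prime_gt1.
    move: lt_pm; set P := p ^ m; nia.
  suff -> : x = 2 ^ m by rewrite p2 in lt_pm *; lia.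
  have : c < 2 by rewrite ltn_divLR // -p2.
  by rewrite /x p2; case: (c) c_gt0 => [//|[|//]] _ _; rewrite mul1n.
have := logn_bin_le1 p_pr (dvdn_mull c (dvdnn _)) small.
apply/negP; rewrite -ltnNge -pfactor_dvdn ?bin_gt0 ?leq_addl //.
exact: dvdn_trans pPhi Phi_dvd.
Qed.
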